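(* Let $f:\Omega\subseteq\mathbb{R}^d\to\mathbb{R}$ and a bounded probability density $\pi$ on $\mathbb{R}^d$ satisfy: (i) $f$ is continuous with a finite global minimum value $f^*$, i.e. $f(x)\geq f^*$ for all $x\in\Omega$; (ii) the set of global minima $\Omega^*=\{x\in\Omega: f(x)=f^*\}$ is non-empty; (iii) $\pi(x)>0$ for every $x\in\mathbb{R}^d$ and $\int_{\mathbb{R}^d}\pi(x)\,dx=1$. For each $k>0$, let $\Omega_k=\{x\in\Omega: m_k(x)\geq m_k(\tilde{x})\ \forall\,\tilde{x}\in\Omega\}$ denote the set of maximizers of the nascent minima distribution density $m_k$ associated with $f$ and $\pi$. Then for any sequence $\{x_k^*\}$ with $x_k^*\in\Omega_k$, $$\lim_{k\to\infty}f(x_k^* )=f^*.$$ If, in addition, $f$ satisfies the strong separability condition, then $$\lim_{k\to\infty}\ \inf_{\tilde{x}\in\Omega^*}\|x_k^*-\tilde{x}\|=0.$$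
   Context: All integrals are with respect to Lebesgue measure on $\mathbb{R}^d$. For $k\geq 0$ the nascent minima distribution density is $$m_k(x)=\frac{e^{-kf(x)}\,\pi(x)}{\int_{\Omega}e^{-kf(t)}\,\pi(t)\,dt},\qquad x\in\Omega,$$ where $\Omega\subseteq\mathbb{R}^d$ is (measurable and) such that the denominator is a finite positive quantity for every $k\geq 0$. Strong separability condition: $f$ (with $\Omega^*\neq\emptyset$) satisfies strong separability if, for any given $\delta>0$, $$\inf\{f(x): x\in\Omega,\ x\notin\Omega^*,\ \|x-\tilde{x}\|>\delta\}>f^*\quad\text{for any }\tilde{x}\in\Omega^*.$$ (The infimum over the empty set is $+\infty$.) *)

(* Defs.v *)
From HB Require Import structures.
From mathcomp Require Import all_boot all_order all_algebra.
From mathcomp Require Import all_classical all_reals all_analysis.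

Set Implicit Arguments.
Unset Strict Implicit.
Unset Printing Implicit Defensive.

Import Order.TTheory GRing.Theory Num.Theory.
Import numFieldNormedType.Exports.

Local Open Scope classical_set_scope.
Local Open Scope ring_scope.

(* The canonical norm of 'rV[R]_d is the sup norm; its topology, which is the
   one used for continuity, is also the topology of the norm below. *)
Definition enorm (R : realType) (d : nat) (x : 'rV[R]_d) : R :=
  Num.sqrt (\sum_(i < d) x ord0 i ^+ 2).

Section LebesgueMeasure.
Variables (R : realType) (d : nat).
Local Notation E := 'rV[R]_d.

(* The half-open box  prod_i ]a_i, b_i]  given by ab = Some (a, b), and the
   empty set for None.  None only matters for d = 0, where no pair (a, b)
   denotes the empty set. *)
Definition box (ab : option (E * E)) : set E :=
  if ab is Some (a, b)
  then [set x | forall i, a ord0 i < x ord0 i <= b ord0 i] else set0.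

Definition box_volume (ab : option (E * E)) : R :=
  if ab is Some (a, b)
  then \prod_(i < d) Num.max 0 (b ord0 i - a ord0 i) else 0.

Local Open Scope ereal_scope.

Definition lebesgue_outer (X : set E) : \bar R :=
  ereal_inf [set \sum_(k <oo) (box_volume (B k))%:E |
    B in [set B : nat -> option (E * E) | X `<=` \bigcup_k box (B k)]].

Lemma box_volume_ge0 ab : 0 <= (box_volume ab)%:E.
Proof.
rewrite lee_fin; case: ab => [[a b]|//].
by apply: prodr_ge0 => i _; rewrite le_max lexx.
Qed.
#[local] Hint Resolve box_volume_ge0 : core.

Lemma lebesgue_outer_ge0 X : 0 <= lebesgue_outer X.
Proof.
by apply: le_ereal_inf_tmp => _ [B _ <-]; apply: nneseries_ge0 => *.
Qed.

Lemma lebesgue_outer0 : lebesgue_outer set0 = 0.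
Proof.
apply/eqP; rewrite eq_le lebesgue_outer_ge0 andbT.
apply: ereal_inf_lbound; exists (fun=> None) => //.
by rewrite eseries0.
Qed.

Lemma le_lebesgue_outer : {homo lebesgue_outer : A B / A `<=` B >-> A <= B}.
Proof.
move=> A B AB; apply/ereal_inf_le_tmp => _ [C BC <-].
by exists C => //; exact: subset_trans AB BC.
Qed.

Lemma lebesgue_outer_sigma_subadditive : sigma_subadditive lebesgue_outer.
Proof.
move=> A; have [[i ioo]|] := pselect (exists i, lebesgue_outer (A i) = +oo).
  rewrite (eseries_pinfty _ _ ioo) ?leey// => n _.
  by rewrite -ltNye (lt_le_trans _ (lebesgue_outer_ge0 _)).
rewrite -forallNE => Aoo.
suff add2e (e : {posnum R}) : lebesgue_outer (\bigcup_n A n) <=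
    \sum_(i <oo) lebesgue_outer (A i) + e%:num%:E.
  by apply/lee_addgt0Pr => _/posnumP[].
rewrite (le_trans _ (epsilon_trick _ _ _))//; last first.
  by move=> n; exact: lebesgue_outer_ge0.
pose P n (B : nat -> option (E * E)) := A n `<=` \bigcup_k box (B k) /\
  \sum_(k <oo) (box_volume (B k))%:E <=
    lebesgue_outer (A n) + (e%:num / (2 ^ n.+1)%:R)%:E.
have [G PG] : {G : nat -> nat -> option (E * E) & forall n, P n (G n)}.
  apply: (@choice _ _ P) => n; rewrite /P.
  have en1 : (0 < e%:num / (2 ^ n.+1)%:R)%R by [].
  have fA : lebesgue_outer (A n) \is a fin_num.
    by rewrite ge0_fin_numE ?lebesgue_outer_ge0// ltey; exact/eqP/Aoo.
  have [_ [B AB <-] BA] := lb_ereal_inf_adherent en1 fA.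
  by exists B; split => //; exact/ltW.
pose v (p : nat * nat) := (box_volume (G p.1 p.2))%:E.
have v0 p : 0 <= v p by exact: box_volume_ge0.
apply: (@le_trans _ _ (\esum_(i in setT) v i)).
  have /card_esym/ppcard_eqP[f] := card_nat2.
  apply: ereal_inf_lbound; exists (fun k => G (f k).1 (f k).2).
    move=> t [i _ /((PG i).1 t)[j _ Gt]].
    by exists (f^-1%FUN (i, j)) => //; rewrite invK ?inE.
  by rewrite -(esum_pred_image v f xpredT) ?[fun=> _]set_true// image_eq.
rewrite (_ : esum _ _ = \sum_(i <oo) \sum_(j <oo) v (i, j)); last first.
  pose J : nat -> set (nat * nat) := fun i => [set (i, j) | j in setT].
  rewrite (_ : setT = \bigcup_k J k); last first.
    by rewrite predeqE => -[a b]; split => // _; exists a => //; exists b.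
  rewrite esum_bigcupT //=; last first.
    apply/trivIsetP => i j _ _ ij.
    rewrite predeqE => -[n m] /=; split => //= -[] [_] _ [<-{n} _].
    by move=> [m' _] [] /esym/eqP; rewrite (negbTE ij).
  rewrite -(image_id [set: nat]) -fun_true esum_pred_image//; last first.
    by move=> n _; exact: esum_ge0.
  apply: eq_eseriesr => /= j _.
  rewrite -(esum_pred_image v (pair j) predT)//=; last first.
    by move=> ? ? _ _; exact: (@can_inj _ _ _ snd).
  by congr esum; rewrite predeqE => -[a b]; split; move=> [i _ <-]; exists i.
apply: lee_nneseries => n *; last exact: (PG n).2.
by apply: nneseries_ge0 => m _ _; exact: v0 (n, m).
Qed.

HB.instance Definition _ := isOuterMeasure.Build R E lebesgue_outer
  lebesgue_outer0 lebesgue_outer_ge0 le_lebesgue_outer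
  lebesgue_outer_sigma_subadditive.

(* R^d with the sigma-algebra of Lebesgue (= Caratheodory) measurable sets. *)
Definition lebesgueE := caratheodory_type lebesgue_outer.
HB.instance Definition _ := Measurable.on lebesgueE.

Definition lebesgueRd : set lebesgueE -> \bar R := lebesgue_outer.

Let lebesgueRd_semi_sigma_additive : semi_sigma_additive lebesgueRd.
Proof.
by move=> F mF tF mUF; exact: (@caratheodory_measure_sigma_additive _ _
  (lebesgue_outer : {outer_measure set E -> \bar R})).
Qed.

HB.instance Definition _ := isMeasure.Build _ lebesgueE R lebesgueRd
  lebesgue_outer0 lebesgue_outer_ge0 lebesgueRd_semi_sigma_additive.

End LebesgueMeasure.

Section NascentMinima.
Variables (R : realType) (d : nat).
Local Notation E := 'rV[R]_d.
Variables (Omega : set E) (f pi : E -> R).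

Definition nascent_mass (k : R) : \bar R :=
  (\int[@lebesgueRd R d]_(t in Omega) (expR (- k * f t) * pi t)%:E)%E.

Definition nascent_density (k : R) (x : E) : R :=
  expR (- k * f x) * pi x / fine (nascent_mass k).

Definition nascent_maximizers (k : R) : set E :=
  [set x | Omega x /\
    forall y, Omega y -> nascent_density k y <= nascent_density k x].

Definition minimizers (fstar : R) : set E := [set x | Omega x /\ f x = fstar].

Definition strong_separability (fstar : R) : Prop :=
  forall delta : R, 0 < delta ->
  forall xt : E, minimizers fstar xt ->
  (fstar%:E < ereal_inf [set (f x)%:E | x in
     [set x | Omega x /\ ~ minimizers fstar x /\
              (delta < enorm (x - xt))%R]])%E.

End NascentMinima.

Definition set_dist (R : realType) (d : nat) (x : 'rV[R]_d)
    (A : set 'rV[R]_d) : R :=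
  inf [set enorm (x - a) | a in A].

(* Main.v *)
Require Import Defs.
From mathcomp Require Import all_boot all_order all_algebra.
From mathcomp Require Import all_classical all_reals all_analysis.
Import Order.TTheory GRing.Theory Num.Theory.
Import numFieldNormedType.Exports.
Local Open Scope classical_set_scope.
Local Open Scope ring_scope.

(** Since the normalizing constant of the density [m_k] is positive, a maximizer
    [x_k] of [m_k] also maximizes [e^(-k f) pi].  Comparing [x_k] with one fixed
    global minimum [a], and bounding [pi] above by [M], gives
    [e^(k (f x_k - fstar)) <= pi x_k / pi a <= M / pi a].
    As [k (f x_k - fstar) <= e^(k (f x_k - fstar))], this yields the
    quantitative estimate [0 <= f x_k - fstar <= (M / pi a) / k]
    ([maximizer_gap]), hence the convergence of the values.

    Under strong separability at the same point [a], a point whose value is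
    close enough to [fstar] either is a global minimum or lies within [delta] of
    [a]; in both cases its distance to the set of minima is at most [delta]
    ([cvg_set_dist_minimizers]).

    Integer and real [k] are treated at once by letting the parameter be a
    function [k : T -> R] that tends to [+oo] along an arbitrary filter. *)

Lemma enorm_ge0 {R : realType} {d : nat} {x : 'rV[R]_d} : 0 <= enorm x.
Proof. exact: sqrtr_ge0. Qed.

Lemma enorm0 {R : realType} {d : nat} : enorm (0 : 'rV[R]_d) = 0.
Proof.
by rewrite /enorm big1 ?sqrtr0// => i _; rewrite mxE expr0n.
Qed.

Lemma set_dist_ge0 {R : realType} {d : nat} {x : 'rV[R]_d} {A : set 'rV[R]_d} :
  A !=set0 -> 0 <= set_dist x A.
Proof.
move=> [a Aa]; apply: lb_le_inf; first by exists (enorm (x - a)), a.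
by move=> _ [b _ <-]; exact: enorm_ge0.
Qed.

Lemma set_dist_le {R : realType} {d : nat} {x a : 'rV[R]_d}
    {A : set 'rV[R]_d} : A a -> set_dist x A <= enorm (x - a).
Proof.
move=> Aa; apply: ge_inf; last by exists a.
by exists 0 => _ [b _ <-]; exact: enorm_ge0.
Qed.

Lemma nascent_maximizer_weight {R : realType} {d : nat} {Omega : set 'rV[R]_d}
    {f pi : 'rV[R]_d -> R} {k : R} {x y : 'rV[R]_d} :
  (0 < nascent_mass Omega f pi k < +oo)%E ->
  nascent_maximizers Omega f pi k x -> Omega y ->
  expR (- k * f y) * pi y <= expR (- k * f x) * pi x.
Proof.
move=> /fine_gt0 mass_gt0 [_ xmax] Oy.
by have := xmax y Oy; rewrite /nascent_density ler_pM2r// invr_gt0.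
Qed.

(** The rate [1 / k] comes from the crude bound [t <= e^t], which suffices for
    the limit; taking logarithms instead would only improve the constant. *)
Lemma maximizer_gap {R : realType} {d : nat} {Omega : set 'rV[R]_d}
    {f pi : 'rV[R]_d -> R} {fstar k M : R} {x a : 'rV[R]_d} :
  (0 < nascent_mass Omega f pi k < +oo)%E ->
  0 < k -> 0 < pi a -> pi x <= M ->
  minimizers Omega f fstar a -> nascent_maximizers Omega f pi k x ->
  f x - fstar <= M / pi a / k.
Proof.
move=> massk k_gt0 pia_gt0 piM [Oa fa] xmax.
have := nascent_maximizer_weight massk xmax Oa.
rewrite fa => weight_le.
rewrite ler_pdivlMr// ler_pdivlMr//.
apply: le_trans piM.
rewrite -(ler_pM2l (expR_gt0 (- k * f x))).
apply: le_trans weight_le.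
rewrite mulrA ler_pM2r//.
have -> : - k * fstar = - k * f x + (f x - fstar) * k.
  by rewrite mulrBl !mulNr (mulrC k (f x)) addKr mulrC.
rewrite expRD ler_pM2l ?expR_gt0//.
by apply: le_trans (expR_ge1Dx _); rewrite lerDr.
Qed.

Lemma cvg_maximizers_value {R : realType} {d : nat} {Omega : set 'rV[R]_d}
    {f pi : 'rV[R]_d -> R} {fstar : R} {T : Type} {F : set_system T}
    {FF : Filter F} {k : T -> R} {x : T -> 'rV[R]_d} :
  (forall k : R, 0 <= k -> (0 < nascent_mass Omega f pi k < +oo)%E) ->
  (forall x, Omega x -> fstar <= f x) ->
  minimizers Omega f fstar !=set0 ->
  [bounded pi x | x in [set: 'rV[R]_d]] ->
  (forall x, 0 < pi x) ->
  k t @[t --> F] --> +oo ->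
  (\forall t \near F, nascent_maximizers Omega f pi (k t) (x t)) ->
  f (x t) @[t --> F] --> fstar.
Proof.
move=> mass_fin f_ge [a amin] pi_bnd pi_gt0 k_oo xmax.
have [M piM] := (ex_bound pi (PF := globally_properfilter (a := a) I)).1 pi_bnd.
have {}piM y : pi y <= M.
  exact: le_trans (ler_norm _) (piM y I).
apply/cvgrPdist_le => e e_gt0.
have k_gt0 : \forall t \near F, 0 < k t by apply: (cvgryPgt _).1.
have k_large : \forall t \near F, M / pi a / e <= k t by apply: (cvgryPge _).1.
near=> t.
have kt_gt0 : 0 < k t by near: t.
have xt_max : nascent_maximizers Omega f pi (k t) (x t) by near: t.
rewrite distrC ger0_norm ?subr_ge0; last by apply: f_ge; case: xt_max.
apply: le_trans (maximizer_gap (mass_fin _ (ltW kt_gt0))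
  kt_gt0 (pi_gt0 a) (piM _) amin xt_max) _.
by rewrite ler_pdivrMr// (mulrC e) -ler_pdivrMr//; near: t.
Unshelve. all: by end_near. Qed.

(** Separability at a single minimum [a] is enough: it need not be the minimum
    closest to [x t], since a point far from [a] whose value is below the
    separating infimum is itself a minimum, at distance zero from the set. *)
Lemma cvg_set_dist_minimizers {R : realType} {d : nat} {Omega : set 'rV[R]_d}
    {f : 'rV[R]_d -> R} {fstar : R} {T : Type} {F : set_system T}
    {FF : Filter F} {x : T -> 'rV[R]_d} :
  minimizers Omega f fstar !=set0 ->
  strong_separability Omega f fstar ->
  (\forall t \near F, Omega (x t)) ->
  f (x t) @[t --> F] --> fstar ->
  set_dist (x t) (minimizers Omega f fstar) @[t --> F] --> (0 : R).
Proof.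
move=> min_nonempty sep Ox fx_cvg; have [a amin] := min_nonempty.
apply/cvgr0Pnorm_le => delta delta_gt0.
have := sep delta delta_gt0 a amin; set I := ereal_inf _ => I_gt.
have fx_lt : \forall t \near F, ((f (x t))%:E < I)%E.
  (* the infimum is infinite when no nonminimal point is far from a *)
  case: I I_gt => [r||//]; last by move=> _; near=> t; rewrite ltry.
  rewrite lte_fin => r_gt; near=> t; rewrite lte_fin; near: t.
  exact: cvgr_lt fx_cvg _ r_gt.
near=> t.
rewrite ger0_norm ?set_dist_ge0//.
have [xt_min|xt_nmin] := pselect (minimizers Omega f fstar (x t)).
  by apply: le_trans (set_dist_le xt_min) _; rewrite subrr enorm0 ltW.
apply: le_trans (set_dist_le amin) _.
rewrite leNgt; apply/negP => xt_far.
have : ((f (x t))%:E < I)%E by near: t.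
rewrite ltNge => /negP; apply; apply: ereal_inf_lbound; exists (x t) => //.
by split=> //; near: t.
Unshelve. all: by end_near. Qed.

Theorem theorem3 (R : realType) (d : nat) (Omega : set 'rV[R]_d)
    (f pi : 'rV[R]_d -> R) (fstar : R)
    (Omega_meas : measurable (Omega : set (lebesgueE R d)))
    (mass_fin : forall k : R, 0 <= k ->
       (0 < nascent_mass Omega f pi k < +oo)%E)
    (f_cont : {within Omega, continuous f})
    (f_ge : forall x, Omega x -> fstar <= f x)
    (min_nonempty : minimizers Omega f fstar !=set0)
    (pi_meas : measurable_fun [set: lebesgueE R d] (pi : lebesgueE R d -> R))
    (pi_bounded : [bounded pi x | x in [set: 'rV[R]_d]])
    (pi_gt0 : forall x, 0 < pi x)
    (pi_mass : (\int[@lebesgueRd R d]_x (pi x)%:E = 1)%E) :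
  (forall x : nat -> 'rV[R]_d,
     (forall k : nat, (0 < k)%N -> nascent_maximizers Omega f pi k%:R (x k)) ->
     f (x k) @[k --> \oo] --> fstar /\
     (strong_separability Omega f fstar ->
      set_dist (x k) (minimizers Omega f fstar) @[k --> \oo] --> (0 : R)))
  /\
  (forall x : R -> 'rV[R]_d,
     (forall k : R, 0 < k -> nascent_maximizers Omega f pi k (x k)) ->
     f (x k) @[k --> +oo] --> fstar /\
     (strong_separability Omega f fstar ->
      set_dist (x k) (minimizers Omega f fstar) @[k --> +oo] --> (0 : R))).
Proof.
have cvg_both (T : Type) (F : set_system T) (FF : Filter F) (k : T -> R)
    (x : T -> 'rV[R]_d) : k t @[t --> F] --> +oo ->
    (\forall t \near F, nascent_maximizers Omega f pi (k t) (x t)) ->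
    f (x t) @[t --> F] --> fstar /\
    (strong_separability Omega f fstar ->
     set_dist (x t) (minimizers Omega f fstar) @[t --> F] --> (0 : R)).
  move=> k_oo xmax.
  have fx_cvg : f (x t) @[t --> F] --> fstar.
    exact: (cvg_maximizers_value mass_fin f_ge
      min_nonempty pi_bounded pi_gt0 k_oo xmax).
  split=> // sep; apply: cvg_set_dist_minimizers => //.
  by apply: filterS xmax => t [].
split=> x xmax; apply: cvg_both.
- exact: cvgr_idn.
- by near=> k; apply: xmax; near: k; exact: nbhs_infty_gt.
- exact: cvg_id.
- by near=> k; apply: xmax; near: k; exact: nbhs_pinfty_gt.
Unshelve. all: by end_near. Qed.
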